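(* Suppose that in algorithm WS-MULT (described in the context) the shared object $Head$ is an instance of the wait-free linearizable Read/Write bounded MaxRegister algorithm of Aspnes, Attiya and Censor-Hillel (described in the context). Then WS-MULT is set-linearizable and uses only Read/Write instructions, and Take and Steal have step complexity $O(\log m)$, where $m$ is the maximum number of tasks that can be inserted in an execution. Furthermore, Take and Steal do not use Read-After-Write synchronization patterns.
   Context: Model: $n\ge 2$ asynchronous, crash-prone processes $p_0,\dots,p_{n-1}$ communicate through atomic base objects; each atomic operation on a base object is one step. $p_0$ is the owner, which invokes Put and Take. The other processes are thieves, which invoke Steal. The step complexity of an operation is the maximum number of steps a process needs to complete it. A Read-After-Write synchronization pattern occurs when, within one high-level operation, a process writes a shared variable and afterwards reads a shared variable. Executions, concurrency ($<_E$) and set-linearizability are the standard notions: a finite execution is set-linearizable if its completed (and possibly some pending) operations can be grouped into concurrency classes and ordered into an execution of the set-sequential specification, respecting real-time order $<_E$ and agreeing on inputs and outputs. (FIFO) work-stealing with multiplicity is the following set-sequential specification. States are finite strings over $\mathbb N=\{1,2,\dots\}$, with initial state $\epsilon$ and the head first. - ${\sf Put}(x)$ appends $x$ and returns true. - From state $x\cdot q$, a concurrency class consisting of at most one Take and $t$ Steals ($0\le t\le n-1$, with at least one operation in total) moves to $q$, and all operations in the class return $x$. - In state $\epsilon$, a single Take or a single Steal returns empty. A MaxRegister offers MaxRead, which returns the maximum value written so far, and MaxWrite$(v)$, which writes $v$ only if it exceeds the current maximum. Algorithm WS-MULT. Shared: $Head$ (MaxRegister, initially $1$); array $Tasks[1,2,\dots]$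 of atomic Read/Write registers with $Tasks[1]=Tasks[2]=\bot$. The owner has a local $tail\leftarrow0$. - Put$(x)$: $tail\leftarrow tail+1$; write $x$ to $Tasks[tail]$ and $\bot$ to $Tasks[tail+2]$, in either order; return true. - Take$()$: $head\leftarrow Head.{\sf MaxRead}()$; if $head\le tail$, read $x\leftarrow Tasks[head]$ and perform $Head.{\sf MaxWrite}(head+1)$, in either order, then return $x$; else return empty. - Steal$()$: $head\leftarrow Head.{\sf MaxRead}()$; $x\leftarrow Tasks[head].{\sf Read}()$; if $x\ne\bot$, perform $Head.{\sf MaxWrite}(head+1)$ and return $x$; else return empty. Bounded MaxRegister of Aspnes–Attiya–Censor-Hillel, storing values in a range of size $m$. It is built from a binary tree of height $O(\log m)$ with an atomic bit, initially $0$, at each node; equivalently, a max register of size $m$ is built recursively from a switch bit and two max registers of size $m/2$. - MaxRead reads the bits along one root-to-leaf path, choosing the next node according to the bit read, and returns the value corresponding to the leaf reached. - MaxWrite$(v)$ reads bits along the root-to-leaf path determined by the binary representation of $v$. If $v$ exceeds the current value, it then writes $1$, bottom-up, into the nodes on that path that contain $0$. Both operations take $O(\log m)$ steps, and both use only Read/Write.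
   Formalization: The absence of Read-After-Write patterns in Take is claimed only for the order in which Take reads Tasks[head] before Head.MaxWrite(head+1); in the other order Take writes bits of Head and then reads Tasks[head], so the claim fails. *)

(* Defs.v *)
From mathcomp Require Import all_boot.

Set Implicit Arguments.
Unset Strict Implicit.
Unset Printing Implicit Defensive.

(* High-level operations and their outputs.  Tasks are elements of
   N = {1,2,...}; the register value 0 plays the role of bottom.      *)
Inductive op := OPut (x : nat) | OTake | OSteal.
Inductive resp := RTrue | RVal (x : nat) | REmpty.

Definition resp_eqb (a b : resp) : bool :=
  match a, b with
  | RTrue, RTrue => true
  | RVal x, RVal y => x == y
  | REmpty, REmpty => true
  | _, _ => false
  end.

(* Base objects: the bits of the max-register tree (heap-indexed,
   root = 1, children 2i and 2i+1) and the registers Tasks[i]. *)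
Inductive loc := LBit (i : nat) | LTask (i : nat).

Definition loc_eqb (a b : loc) : bool :=
  match a, b with
  | LBit i, LBit j => i == j
  | LTask i, LTask j => i == j
  | _, _ => false
  end.

(* Code of one high-level operation: a tree of atomic primitives on
   base objects.  CAS is included so that "uses only Read/Write" is a
   genuine property and not a consequence of the syntax. *)
Inductive prog :=
| Ret (r : resp)
| Read (l : loc) (k : nat -> prog)
| Write (l : loc) (v : nat) (k : prog)
| CAS (l : loc) (old new : nat) (k : bool -> prog).

(* Aspnes--Attiya--Censor-Hillel max register of size 2^h (values
   0 .. 2^h-1), built recursively from a switch bit and two max
   registers of size 2^(h-1).  The subtree rooted at node i. *)
Fixpoint mr_read (h node : nat) (k : nat -> prog) : prog :=
  match h with
  | 0 => k 0
  | h'.+1 =>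
      Read (LBit node) (fun b =>
        if b == 0 then mr_read h' node.*2 k
        else mr_read h' node.*2.+1 (fun v => k (2 ^ h' + v)))
  end.

Fixpoint mr_write (h node v : nat) (k : prog) : prog :=
  match h with
  | 0 => k
  | h'.+1 =>
      if v < 2 ^ h' then
        Read (LBit node) (fun b =>
          if b == 0 then mr_write h' node.*2 v k else k)
      else mr_write h' node.*2.+1 (v - 2 ^ h') (Write (LBit node) 1 k)
  end.

(* Head: max register initially 1.  Value v is stored as v - 1 in the
   AAC register (whose bits are all initially 0, i.e. value 0). *)
Definition head_read (h : nat) (k : nat -> prog) : prog :=
  mr_read h 1 (fun v => k v.+1).
Definition head_write (h v : nat) (k : prog) : prog :=
  mr_write h 1 v.-1 k.

(* Height of the tree when at most m tasks are inserted: Head takes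
   values in 1 .. m+1, stored as 0 .. m, so 2^h >= m+1. *)
Definition head_height (m : nat) : nat := up_log 2 m.+1.

(* Algorithm WS-MULT.  The boolean parameters select the order of the
   two accesses that the algorithm allows "in either order":
   put_first_x = true : write x to Tasks[tail] before bottom to Tasks[tail+2];
   take_read_first = true : read Tasks[head] before Head.MaxWrite(head+1). *)
Definition put_prog (put_first_x : bool) (tail x : nat) : prog :=
  (* tail is the already incremented local tail *)
  if put_first_x then Write (LTask tail) x (Write (LTask tail.+2) 0 (Ret RTrue))
  else Write (LTask tail.+2) 0 (Write (LTask tail) x (Ret RTrue)).

Definition take_prog (h : nat) (take_read_first : bool) (tail : nat) : prog :=
  head_read h (fun hd =>
    if hd <= tail then
      if take_read_first then
        Read (LTask hd) (fun x => head_write h hd.+1 (Ret (RVal x)))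
      else head_write h hd.+1 (Read (LTask hd) (fun x => Ret (RVal x)))
    else Ret REmpty).

Definition steal_prog (h : nat) : prog :=
  head_read h (fun hd =>
    Read (LTask hd) (fun x =>
      if x == 0 then Ret REmpty else head_write h hd.+1 (Ret (RVal x)))).

Definition op_prog (h : nat) (pf tf : bool) (tail : nat) (o : op) : prog :=
  match o with
  | OPut x => put_prog pf tail x
  | OTake => take_prog h tf tail
  | OSteal => steal_prog h
  end.

Inductive only_rw : prog -> Prop :=
| ORW_ret r : only_rw (Ret r)
| ORW_read l k : (forall v, only_rw (k v)) -> only_rw (Read l k)
| ORW_write l v k : only_rw k -> only_rw (Write l v k).

Inductive steps_le : prog -> nat -> Prop :=
| SL_ret r s : steps_le (Ret r) s
| SL_read l k s : (forall v, steps_le (k v) s) -> steps_le (Read l k) s.+1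
| SL_write l v k s : steps_le k s -> steps_le (Write l v k) s.+1
| SL_cas l a b k s : (forall c, steps_le (k c) s) -> steps_le (CAS l a b k) s.+1.

Inductive no_read : prog -> Prop :=
| NR_ret r : no_read (Ret r)
| NR_write l v k : no_read k -> no_read (Write l v k).

Inductive no_raw : prog -> Prop :=
| NW_ret r : no_raw (Ret r)
| NW_read l k : (forall v, no_raw (k v)) -> no_raw (Read l k)
| NW_write l v k : no_read k -> no_raw (Write l v k)
| NW_cas l a b k : (forall c, no_read (k c)) -> no_raw (CAS l a b k).

(* Executions.  Processes are 0 .. n-1, process 0 is the owner.
   A crash is modelled by a process taking no further events. *)
Inductive event := EInv (p : nat) (o : op) | EStep (p : nat) | EResp (p : nat) (r : resp).

Record config := Cfg {
  cmem : loc -> nat;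
  ctail : nat;
  cpend : nat -> option (op * prog) }.

Definition upd (m : loc -> nat) (l : loc) (v : nat) : loc -> nat :=
  fun l' => if loc_eqb l l' then v else m l'.
Definition updp (f : nat -> option (op * prog)) (p : nat) (x : option (op * prog)) :=
  fun q => if q == p then x else f q.

Definition allowed (n p : nat) (o : op) : bool :=
  match o with
  | OPut x => (p == 0) && (0 < x)
  | OTake => p == 0
  | OSteal => (0 < p) && (p < n)
  end.

Definition exec_event (n h : nat) (pf tf : bool) (c : config) (e : event) : option config :=
  match e with
  | EInv p o =>
      match cpend c p with
      | Some _ => None
      | None =>
          if allowed n p o then
            let t := if o is OPut _ then (ctail c).+1 else ctail c in
            Some (Cfg (cmem c) t (updp (cpend c) p (Some (o, op_prog h pf tf t o))))
          else None
      end
  | EStep p =>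
      match cpend c p with
      | Some (o, Read l k) =>
          Some (Cfg (cmem c) (ctail c) (updp (cpend c) p (Some (o, k (cmem c l)))))
      | Some (o, Write l v k) =>
          Some (Cfg (upd (cmem c) l v) (ctail c) (updp (cpend c) p (Some (o, k))))
      | Some (o, CAS l a b k) =>
          if cmem c l == a then
            Some (Cfg (upd (cmem c) l b) (ctail c) (updp (cpend c) p (Some (o, k true))))
          else Some (Cfg (cmem c) (ctail c) (updp (cpend c) p (Some (o, k false))))
      | _ => None
      end
  | EResp p r =>
      match cpend c p with
      | Some (_, Ret r') =>
          if resp_eqb r r' then Some (Cfg (cmem c) (ctail c) (updp (cpend c) p None))
          else None
      | _ => None
      end
  end.

Fixpoint run (n h : nat) (pf tf : bool) (c : config) (E : seq event) : option config :=
  match E with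
  | [::] => Some c
  | e :: E' =>
      match exec_event n h pf tf c e with
      | Some c' => run n h pf tf c' E'
      | None => None
      end
  end.

(* Initial configuration: all tree bits 0 (Head = 1), Tasks[i] = init i
   (arbitrary initial contents, with Tasks[1] = Tasks[2] = bottom imposed
   by hypothesis), owner's tail = 0, no pending operation. *)
Definition init_cfg (init : nat -> nat) : config :=
  Cfg (fun l => match l with LBit _ => 0 | LTask i => init i end) 0 (fun _ => None).

Definition is_execution (n h : nat) (pf tf : bool) (init : nat -> nat) (E : seq event) : Prop :=
  exists c, run n h pf tf (init_cfg init) E = Some c.

Definition num_puts (E : seq event) : nat :=
  count (fun e => if e is EInv _ (OPut _) then true else false) E.

(* Histories.  An operation is identified by the index of its
   invocation event in E. *)
Definition dflt_ev : event := EStep 0.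

Definition inv_of (E : seq event) (i : nat) : option op :=
  match nth dflt_ev E i with EInv _ o => Some o | _ => None end.

Definition resp_of (E : seq event) (i : nat) : option (nat * resp) :=
  match nth dflt_ev E i with
  | EInv p _ =>
      let s := drop i.+1 E in
      let j := find (fun e => if e is EResp q _ then q == p else false) s in
      match nth dflt_ev s j with
      | EResp _ r => Some (i.+1 + j, r)
      | _ => None
      end
  | _ => None
  end.

Definition class_step (n : nat) (q : seq nat) (c : seq (op * resp)) : option (seq nat) :=
  match c with
  | [:: (OPut x, RTrue)] => Some (rcons q x)
  | [:: (OTake, REmpty)] => if q is [::] then Some [::] else None
  | [:: (OSteal, REmpty)] => if q is [::] then Some [::] else None
  | _ =>
      match q with
      | [::] => None
      | x :: q' =>
          if [&& 0 < size c,
                 all (fun pr => match pr with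
                                | (OTake, RVal y) => y == x
                                | (OSteal, RVal y) => y == x
                                | _ => false end) c,
                 count (fun pr => if pr.1 is OTake then true else false) c <= 1 &
                 count (fun pr => if pr.1 is OSteal then true else false) c <= n.-1]
          then Some q' else None
      end
  end.

Fixpoint spec_accepts (n : nat) (q : seq nat) (cs : seq (seq (op * resp))) : bool :=
  match cs with
  | [::] => true
  | c :: cs' =>
      match class_step n q c with
      | Some q' => spec_accepts n q' cs'
      | None => false
      end
  end.

Definition class_members (E : seq event) (cls : nat -> option nat) (out : nat -> resp)
    (k : nat) : seq (op * resp) :=
  pmap (fun i => if cls i == Some k then
                   match inv_of E i with Some o => Some (o, out i) | None => None end
                 else None) (iota 0 (size E)).

(* E is set-linearizable: the operations selected by cls (all completed
   ones, possibly some pending ones) are grouped into classes 0..K-1,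
   each receives an output (the actual one if completed), the classes in
   order form a run of the set-sequential specification, and real-time
   order is respected. *)
Definition set_linearizable (n : nat) (E : seq event) : Prop :=
  exists (K : nat) (cls : nat -> option nat) (out : nat -> resp),
  [/\ forall i k, cls i = Some k -> [/\ k < K, i < size E & inv_of E i <> None],
      forall i j r, resp_of E i = Some (j, r) -> cls i <> None /\ out i = r,
      forall a b ka kb j r, cls a = Some ka -> cls b = Some kb ->
        resp_of E a = Some (j, r) -> j < b -> ka < kb &
      spec_accepts n [::] [seq class_members E cls out k | k <- iota 0 K]].

(* Main.v *)
Require Import Defs.
From mathcomp Require Import all_boot zify.

(* Each value of Head is written only by operations that have read the preceding one,
   so Head increases by steps of one.  Every nonzero value is the threshold of exactly
   one node of the max-register tree, hence the tree is a unary counter: the bit of a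
   node is set exactly when Head has reached its threshold, and of all the writes of a
   MaxWrite at most one is effective.  A MaxRead is then a binary search in a growing
   counter, and what it returns lies between the values of Head at its invocation and
   at its response.

   A Put is linearized when it writes its task, and the class removing a task when Head
   moves past it.  Every operation returning that task read Head before this moment and
   responds after it; so the members of a class are pairwise concurrent, hence belong to
   distinct processes.  A Steal returning empty is linearized when it reads bottom and a
   Take returning empty at its response: at these moments all tasks put are removed. *)

Set Implicit Arguments.
Unset Strict Implicit.
Unset Printing Implicit Defensive.

(** * Syntactic properties of the code: primitives used, step counts, Read-After-Write *)

Lemma only_rw_mr_read h nd k :
  (forall v, only_rw (k v)) -> only_rw (mr_read h nd k).
Proof.
elim: h nd k => [|h IHh] nd k kP //=.
by constructor=> b; case: ifP => _; apply: IHh.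
Qed.

Lemma only_rw_mr_write h nd v k : only_rw k -> only_rw (mr_write h nd v k).
Proof.
elim: h nd v k => [|h IHh] nd v k kP //=.
case: ifP => _; last by apply: IHh; constructor.
by constructor=> b; case: ifP => _ //; apply: IHh.
Qed.

Lemma only_rw_op_prog h pf tf tail o : only_rw (op_prog h pf tf tail o).
Proof.
case: o => [x||] /=.
- by rewrite /put_prog; case: pf; do !constructor.
- apply: only_rw_mr_read => v; case: ifP => _; last exact: ORW_ret.
  case: tf; first by constructor=> x; apply: only_rw_mr_write; constructor.
  by apply: only_rw_mr_write; do !constructor.
- apply: only_rw_mr_read => v; constructor=> x; case: ifP => _; first exact: ORW_ret.
  by apply: only_rw_mr_write; constructor.
Qed.

Lemma steps_le_trans p s t : steps_le p s -> s <= t -> steps_le p t.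
Proof.
move=> ps; elim: ps t => {p s}
  [r s|l k s _ IH|l v k s _ IH|l a b k s _ IH] [|t] //= st;
  constructor; by [apply: IH | move=> ?; apply: IH].
Qed.

Lemma steps_le_mr_read h nd k s :
  (forall v, steps_le (k v) s) -> steps_le (mr_read h nd k) (h + s).
Proof.
elim: h nd k => [|h IHh] nd k kP //=.
by rewrite addSn; constructor=> b; case: ifP => _; apply: IHh.
Qed.

(** Each level costs at most one access: a read for a left turn, a delayed write for a right
    turn. *)
Lemma steps_le_mr_write h nd v k s :
  steps_le k s -> steps_le (mr_write h nd v k) (h + s).
Proof.
elim: h nd v k s => [|h IHh] nd v k s kP //=.
case: ifP => _; last by rewrite addSnnS; apply: IHh; constructor.
rewrite addSn; constructor=> b; case: ifP => _; first exact: IHh.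
by apply: steps_le_trans kP _; apply: leq_addl.
Qed.

Lemma steps_le_take h tf tail : steps_le (take_prog h tf tail) (h + h.+1).
Proof.
apply: steps_le_mr_read => v; case: ifP => _; last exact: SL_ret.
case: tf.
  apply: SL_read => x; apply: (@steps_le_trans _ (h + 0)); last by rewrite addn0.
  by apply: steps_le_mr_write; apply: SL_ret.
apply: (@steps_le_trans _ (h + 1)); last by rewrite addn1.
apply: steps_le_mr_write.
by apply: SL_read => x; apply: SL_ret.
Qed.

Lemma steps_le_steal h : steps_le (steal_prog h) (h + h.+1).
Proof.
apply: steps_le_mr_read => v; apply: SL_read => x; case: ifP => _; first exact: SL_ret.
apply: (@steps_le_trans _ (h + 0)); last by rewrite addn0.
by apply: steps_le_mr_write; apply: SL_ret.
Qed.

Lemma head_height_le m : head_height m <= (trunc_log 2 m).+1.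
Proof.
rewrite /head_height; case: m => [|m]; first by rewrite up_log1.
by rewrite up_log_trunc_log.
Qed.

Lemma ltn_head_height m : m < 2 ^ head_height m.
Proof. exact: up_logP. Qed.

Lemma no_raw_of_no_read p : no_read p -> no_raw p.
Proof. by case=> *; constructor. Qed.

Lemma no_raw_mr_read h nd k :
  (forall v, no_raw (k v)) -> no_raw (mr_read h nd k).
Proof.
elim: h nd k => [|h IHh] nd k kP //=.
by constructor=> b; case: ifP => _; apply: IHh.
Qed.

(** The writes of the right turns accumulate in the continuation, so that the descent consists of
    reads only. After the first write just writes and [k] remain, whence the condition on [k]. *)
Lemma no_raw_mr_write h nd v k : no_read k -> no_raw (mr_write h nd v k).
Proof.
elim: h nd v k => [|h IHh] nd v k kP /=; first exact: no_raw_of_no_read.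
case: ifP => _; last by apply: IHh; constructor.
constructor=> b; case: ifP => _; [exact: IHh | exact: no_raw_of_no_read].
Qed.

Lemma no_raw_steal h : no_raw (steal_prog h).
Proof.
apply: no_raw_mr_read => v; constructor=> x; case: ifP => _; first exact: NW_ret.
by apply: no_raw_mr_write; constructor.
Qed.

Lemma no_raw_take h tail : no_raw (take_prog h true tail).
Proof.
apply: no_raw_mr_read => v; case: ifP => _; last exact: NW_ret.
by constructor=> x; apply: no_raw_mr_write; constructor.
Qed.

(** * The max-register tree *)

Section Tree.

Variable H : nat.

(* The node [nd] is the root of a subtree of height [h] whose leaves carry the
   values [lo, ..., lo + 2 ^ h - 1]. *)
Definition at_node (h nd lo : nat) : Prop :=
  exists d j, [/\ h + d = H, j < 2 ^ d, nd = 2 ^ d + j & lo = j * 2 ^ h].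

Lemma at_root : at_node H 1 0.
Proof. by exists 0, 0; rewrite addn0. Qed.

Lemma at_left h nd lo : at_node h.+1 nd lo -> at_node h nd.*2 lo.
Proof.
case=> d [j [hd jd -> ->]]; exists d.+1, j.*2.
by split; rewrite ?addnS ?expnS //; nia.
Qed.

Lemma at_right h nd lo : at_node h.+1 nd lo -> at_node h nd.*2.+1 (lo + 2 ^ h).
Proof.
case=> d [j [hd jd -> ->]]; exists d.+1, j.*2.+1.
by split; rewrite ?addnS ?expnS //; nia.
Qed.

(* [u] is the least value stored in the right subtree of [nd]: the bit at [nd]
   is to be set exactly when the register holds at least [u]. *)
Definition threshold (nd u : nat) : Prop :=
  exists h lo, at_node h.+1 nd lo /\ u = lo + 2 ^ h.

Lemma threshold_gt0 nd u : threshold nd u -> 0 < u.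
Proof. by case=> h [lo [_ ->]]; rewrite addn_gt0 expn_gt0 orbT. Qed.

Lemma threshold_fun nd u v : threshold nd u -> threshold nd v -> u = v.
Proof.
case=> h [_ [[d [j [hd jd ndE ->]]] ->]] [h' [_ [[d' [j' [hd' jd' ndE' ->]]] ->]]].
(* The depth of a node is the binary logarithm of its heap index. *)
have dE : trunc_log 2 nd = d by apply: trunc_log_eq => //; rewrite expnS; lia.
have dd' : d = d' by rewrite -dE; apply: trunc_log_eq => //; rewrite expnS; lia.
have hh' : h = h' by lia.
by rewrite -dd' in ndE'; rewrite hh'; congr (_ * _ + _); lia.
Qed.

(** A threshold has the form [(2j+1) * 2^h]: its 2-adic valuation gives the height of the node, and
    its odd part the position in the level. *)
Lemma threshold_inj nd nd' u : threshold nd u -> threshold nd' u -> nd = nd'.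
Proof.
have odd_part j h : j * 2 ^ h.+1 + 2 ^ h = j.*2.+1 * 2 ^ h.
  by rewrite mulSn addnC expnS mulnA -muln2.
have log_part j h : logn 2 (j.*2.+1 * 2 ^ h) = h.
  by rewrite lognM // ?expn_gt0 // pfactorK // logn_coprime // coprime2n /= odd_double.
case=> h [_ [[d [j [hd jd -> ->]]] ->]] [h' [_ [[d' [j' [hd' jd' -> ->]]] e]]].
move: e; rewrite !odd_part => e.
have hh' : h = h' by rewrite -(log_part j h) e log_part.
have dd' : d = d' by lia.
move/eqP: e; rewrite -hh' eqn_pmul2r ?expn_gt0 // => /eqP e.
by rewrite dd'; congr (_ + _); lia.
Qed.

Definition bits_ok (mem : loc -> nat) (V : nat) : Prop :=
  forall nd u, threshold nd u -> mem (LBit nd) = (u <= V).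

(** For [u <= V] the bit is 1 already. For [u = V.+1] the values prescribed for [V] and [V.+1]
    differ at [nd] only, by [threshold_inj]. *)
Lemma bits_ok_write mem V nd u :
  bits_ok mem V -> threshold nd u -> u <= V.+1 ->
  bits_ok (upd mem (LBit nd) 1) (maxn V u).
Proof.
move=> ok tu uV nd' u' tu'; rewrite /upd /=.
case: eqP => [e|ne]; first by rewrite -e in tu'; rewrite (threshold_fun tu' tu) leq_max leqnn orbT.
rewrite (ok _ _ tu'); congr nat_of_bool.
have : u' <> u by move=> e; rewrite -e in tu; apply: ne; apply: threshold_inj tu tu'.
lia.
Qed.

Definition writes (nds : seq nat) (k : prog) : prog :=
  foldr (fun nd => Write (LBit nd) 1) k nds.

Definition below (w : nat) (nds : seq nat) : Prop :=
  forall nd, nd \in nds -> exists2 u, threshold nd u & u <= w.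

Definition head_threshold (nds : seq nat) (u : nat) : Prop :=
  if nds is nd :: _ then threshold nd u else False.

(* Residual code of MaxWrite(w) followed by [k].  On the way down, the last right
   turn was taken at the node of threshold [lo], so a descent that reaches the leaf
   [w] starts its writes with the bit of threshold [w], and one that is cut short by
   a bit 1 has seen a value larger than [w]. *)
Inductive writing (V w : nat) (k : prog) : prog -> Prop :=
| WritingDown h nd lo nds :
    at_node h.+1 nd lo -> lo <= w < lo + 2 ^ h -> below w nds ->
    lo = 0 \/ head_threshold nds lo ->
    writing V w k (Read (LBit nd) (fun b =>
      if b == 0 then mr_write h nd.*2 (w - lo) (writes nds k) else writes nds k))
| WritingUp nds :
    below w nds -> w <= V \/ head_threshold nds w -> writing V w k (writes nds k).

(** Needed because other processes may raise the counter during a MaxWrite. *)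
Lemma writing_leq V V' w k p : V <= V' -> writing V w k p -> writing V' w k p.
Proof.
move=> VV'; case=> [h nd lo nds|nds bel []]; first exact: WritingDown.
  by move=> wV; apply: WritingUp => //; left; apply: leq_trans VV'.
by move=> hd; apply: WritingUp => //; right.
Qed.

(** A right turn puts its node in front of [nds] and makes its threshold the new [lo]. At a leaf
    [lo = w], and [0 < w] ensures that some right turn was taken. *)
Lemma writing_mr_write V w k h nd lo nds :
  0 < w -> at_node h nd lo -> lo <= w < lo + 2 ^ h -> below w nds ->
  lo = 0 \/ head_threshold nds lo ->
  writing V w k (mr_write h nd (w - lo) (writes nds k)).
Proof.
move=> w0; elim: h nd lo nds => [|h IHh] nd lo nds ndP wP bel hd /=.
  have {wP} e : lo = w by rewrite expn0 in wP; lia.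
  by apply: WritingUp => //; case: hd => [lo0|]; [lia | rewrite e; right].
case: ltnP => vh; first by apply: WritingDown => //; lia.
rewrite -subnDA -[Write _ _ _]/(writes (nd :: nds) k).
have tnd : threshold nd (lo + 2 ^ h) by exists h, lo.
apply: IHh; last by right.
- exact: at_right.
- by move: wP vh; rewrite expnS; lia.
- move=> nd'; rewrite inE => /orP[/eqP->|]; last exact: bel.
  by exists (lo + 2 ^ h) => //; lia.
Qed.

(** With no write left to perform, the alternative [head_threshold] is void and [w <= V] remains. *)
Lemma writing_Ret V w k r : writing V w k (Ret r) -> k = Ret r /\ w <= V.
Proof. by move e: (Ret r) => p wr; case: p / wr e => // -[|//] _ [wV|//] /= <-. Qed.

End Tree.

(** * Linearization logs *)

Inductive kind := KPut (x : nat) | KVal (x : nat) | KEmpty.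

Definition kind_out (K : kind) : resp :=
  match K with KPut _ => RTrue | KVal x => RVal x | KEmpty => REmpty end.

Definition fits (K : kind) (o : op) : bool :=
  match K, o with
  | KPut x, OPut y => x == y
  | KVal _, (OTake | OSteal) | KEmpty, (OTake | OSteal) => true
  | _, _ => false
  end.

Definition kind_step (q : seq nat) (K : kind) : option (seq nat) :=
  match K, q with
  | KPut x, _ => Some (rcons q x)
  | KVal x, y :: q' => if y == x then Some q' else None
  | KEmpty, [::] => Some [::]
  | _, _ => None
  end.

Definition kind_run (q : seq nat) (Ks : seq kind) : option (seq nat) :=
  foldl (fun oq K => if oq is Some q' then kind_step q' K else None) (Some q) Ks.

Lemma kind_run_rcons q Ks K :
  kind_run q (rcons Ks K) =
    if kind_run q Ks is Some q' then kind_step q' K else None.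
Proof. by rewrite /kind_run foldl_rcons. Qed.

Definition is_resp (p : nat) (e : event) : bool :=
  if e is EResp q _ then q == p else false.

Definition active (E : seq event) (p i : nat) (o : op) : Prop :=
  [/\ i < size E, nth dflt_ev E i = EInv p o &
      forall t, i < t < size E -> ~~ is_resp p (nth dflt_ev E t)].

Lemma active_rcons E e p i o :
  active (rcons E e) p i o <->
  (i = size E /\ e = EInv p o) \/ (active E p i o /\ ~~ is_resp p e).
Proof.
rewrite /active size_rcons; split.
  case; rewrite nth_rcons ltnS leq_eqVlt => /orP[/eqP->|lti].
    by rewrite ltnn eqxx => -> _; left.
  rewrite lti => iE act; right; split; last first.
    by have := act (size E); rewrite nth_rcons ltnn eqxx; apply; rewrite lti /=.
  split=> // t /andP[it tE]; have := act t; rewrite nth_rcons tE; apply.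
  by rewrite it ltnW.
case=> [[-> ->]|[[lti iE act] ne]].
  by split; rewrite // ?nth_rcons ?ltnn ?eqxx // => t; lia.
split; [exact: ltnW | by rewrite nth_rcons lti|].
move=> t /andP[it]; rewrite ltnS leq_eqVlt nth_rcons => /orP[/eqP->|tE].
  by rewrite ltnn eqxx.
by rewrite tE; apply: act; rewrite it.
Qed.

Definition set_at (T : Type) (f : nat -> T) (i : nat) (x : T) : nat -> T :=
  fun j => if j == i then x else f j.

(* [log] is the sequence of concurrency classes linearized so far, [cl] sends an
   operation (the index of its invocation in [E]) to its class, [len t] is the length
   of the log just before event [t], and [q] is the resulting queue.  The bounds
   [len i <= k < len j.+1] on the class [k] of an operation spanning events [i] to
   [j] yield the real-time order. *)
Record log_ok (E : seq event) (log : seq kind) (cl : nat -> option nat)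
    (len : nat -> nat) (q : seq nat) : Prop := LogOk {
  log_run : kind_run [::] log = Some q;
  log_mono : forall s t, s <= t <= size E -> len s <= len t;
  log_end : len (size E) = size log;
  log_class : forall i k, cl i = Some k ->
    [/\ i < size E, k < size log, len i <= k &
        exists p o, nth dflt_ev E i = EInv p o /\ fits (nth KEmpty log k) o];
  log_inhabited : forall k, k < size log -> exists i, cl i = Some k;
  log_single : forall i j k, cl i = Some k -> cl j = Some k ->
    (forall x, nth KEmpty log k <> KVal x) -> i = j;
  log_resp : forall i j p o r, nth dflt_ev E i = EInv p o -> i < j < size E ->
    nth dflt_ev E j = EResp p r ->
    (forall t, i < t < j -> ~~ is_resp p (nth dflt_ev E t)) ->
    exists k, [/\ cl i = Some k, k < len j.+1 & kind_out (nth KEmpty log k) = r] }.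

(** The new class is placed just before the event that will extend [E], so [len (size E)] is raised
    to count it. The bounds [len i <= k] survive, since invocations in [E] have indices below
    [size E]. *)
Lemma log_ok_append E log cl len q p i o K q' :
  log_ok E log cl len q -> active E p i o -> cl i = None -> fits K o ->
  kind_step q K = Some q' ->
  log_ok E (rcons log K) (set_at cl i (Some (size log)))
    (set_at len (size E) (size log).+1) q'.
Proof.
move=> ok [iE iinv _] cli fK qK; case: (ok) => run mono len_end cls inh sgl rsp.
have nth_old k : k < size log -> nth KEmpty (rcons log K) k = nth KEmpty log k.
  by rewrite nth_rcons => ->.
have len_le t : t <= size E -> len t <= set_at len (size E) (size log).+1 t.
  by rewrite /set_at; case: eqP => // ->; rewrite len_end => _; apply: leqnSn.
split.
- by rewrite kind_run_rcons run.
- move=> s t /andP[st tE]; rewrite {2}/set_at; case: eqP => [_|tN].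
    rewrite /set_at; case: eqP => // _; apply: leqW.
    by rewrite -len_end; apply: mono; rewrite leqnn andbT (leq_trans st).
  by rewrite /set_at ltn_eqF; [apply: mono; rewrite st | lia].
- by rewrite /set_at eqxx size_rcons.
- move=> j k; rewrite {1}/set_at size_rcons; case: eqP => [->[<-]|_ /cls[jE kl lk [p' [o' [jinv fk]]]]].
    split; rewrite // ?nth_rcons ?ltnn ?eqxx //; last by exists p, o.
    by rewrite /set_at ltn_eqF // -len_end; apply: mono; rewrite leqnn ltnW.
  split; rewrite // ?ltnS ?(ltnW kl) //; first by rewrite /set_at ltn_eqF.
  by exists p', o'; rewrite nth_old.
- move=> k; rewrite size_rcons ltnS leq_eqVlt => /orP[/eqP->|kl].
    by exists i; rewrite /set_at eqxx.
  have [j jk] := inh _ kl; exists j.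
  by rewrite /set_at; case: eqP => // ji; rewrite ji cli in jk.
- move=> j j' k; rewrite /set_at.
  case: eqP => [->|_]; case: eqP => [->|_] //.
  + by move=> [<-] /cls[_]; rewrite ltnn.
  + by move=> /cls[_ kl _ _] [kE]; rewrite kE ltnn in kl.
  + move=> jk j'k; have [_ kl _ _] := cls _ _ jk; rewrite nth_old //; exact: sgl.
- move=> j t p' o' r jinv jt tresp noresp.
  have [k [jk kt kout]] := rsp _ _ _ _ _ jinv jt tresp noresp.
  have [_ kl _ _] := cls _ _ jk; exists k; rewrite nth_old //; split=> //.
    by rewrite /set_at; case: eqP => // ji; rewrite ji cli in jk.
  by apply: leq_trans kt (len_le _ _); case/andP: jt.
Qed.

(** A removal class linearized earlier may still receive a pending operation: [len i <= k] puts the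
    class after the invocation, and the response is yet to come. *)
Lemma log_ok_join E log cl len q p i o k x :
  log_ok E log cl len q -> active E p i o -> cl i = None \/ cl i = Some k ->
  k < size log -> nth KEmpty log k = KVal x -> len i <= k -> fits (KVal x) o ->
  log_ok E log (set_at cl i (Some k)) len q.
Proof.
move=> ok [iE iinv _] cli kl kx lk fx; case: (ok) => run mono len_end cls inh sgl rsp.
have cl_old j k' : cl j = Some k' -> set_at cl i (Some k) j = Some k'.
  by rewrite /set_at; case: eqP => // -> clk'; case: cli => clk; rewrite clk in clk'.
split=> //.
- move=> j k'; rewrite /set_at; case: eqP => [->[<-]|_ /cls//].
  by split=> //; exists p, o; rewrite kx.
- by move=> k' /inh[j jk']; exists j; apply: cl_old.
- move=> j j' k'; rewrite /set_at; case: eqP => [->|_]; case: eqP => [->|_] //.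
  + by move=> [<-] _ /(_ x); rewrite kx.
  + by move=> _ [<-] /(_ x); rewrite kx.
  + exact: sgl.
- move=> j t p' o' r jinv jt tresp noresp.
  have [k' [jk kt kout]] := rsp _ _ _ _ _ jinv jt tresp noresp.
  by exists k'; rewrite (cl_old _ _ jk).
Qed.

(** Only a response creates an obligation. Its bound [k < len j.+1] is automatic, as the new last
    value of [len] counts the whole log. *)
Lemma log_ok_event E e log cl len q :
  log_ok E log cl len q ->
  (forall p r i o, e = EResp p r -> active E p i o ->
     exists2 k, cl i = Some k & kind_out (nth KEmpty log k) = r) ->
  log_ok (rcons E e) log cl (set_at len (size E).+1 (size log)) q.
Proof.
move=> ok eresp; case: (ok) => run mono len_end cls inh sgl rsp.
have len_old t : t <= size E -> set_at len (size E).+1 (size log) t = len t.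
  by move=> tE; rewrite /set_at ltn_eqF.
split=> //.
- move=> s t /andP[st]; rewrite size_rcons leq_eqVlt => /orP[/eqP tE|tE].
    rewrite {2}/set_at tE eqxx; move: st; rewrite tE leq_eqVlt => /orP[/eqP->|sE].
      by rewrite /set_at eqxx.
    by rewrite len_old // -len_end; apply: mono; rewrite leqnn -ltnS sE.
  rewrite !len_old //; first by apply: mono; rewrite st.
  by apply: leq_trans st _.
- by rewrite size_rcons /set_at eqxx.
- move=> j k /cls[jE kl lk [p [o [jinv fk]]]]; rewrite size_rcons.
  split; rewrite ?len_old // ?ltnS 1?ltnW //.
  by exists p, o; rewrite nth_rcons jE.
- move=> i j p o r; rewrite size_rcons ltnS => iinv /andP[ij].
  rewrite leq_eqVlt => /orP[/eqP jE|jE].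
    have iE : i < size E by rewrite -jE.
    rewrite jE nth_rcons ltnn eqxx => eE noresp.
    have act : active E p i o.
      rewrite nth_rcons iE in iinv.
      by split=> // t tP; have := noresp t tP; rewrite nth_rcons; case/andP: tP => _ ->.
    have [k ik kout] := eresp _ _ _ _ eE act.
    have [_ kl _ _] := cls _ _ ik.
    by exists k; rewrite /set_at eqxx.
  have iE : i < size E by apply: ltn_trans jE.
  move: iinv; rewrite !nth_rcons iE jE len_old // => iinv jresp noresp.
  apply: rsp iinv _ jresp _; rewrite ?ij // => t /andP[it tj].
  by have := noresp t; rewrite nth_rcons (ltn_trans tj jE) it tj => /(_ isT).
Qed.

(** * From a linearization log to a set-linearization *)

Lemma resp_ofE E i :
  resp_of E i =
    if nth dflt_ev E i is EInv p _ then
      let s := drop i.+1 E in let j := find (is_resp p) s in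
      if nth dflt_ev s j is EResp _ r then Some (i.+1 + j, r) else None
    else None.
Proof. by []. Qed.

Lemma resp_ofP E i j r :
  resp_of E i = Some (j, r) ->
  exists p o, [/\ nth dflt_ev E i = EInv p o, i < j < size E,
    nth dflt_ev E j = EResp p r &
    forall t, i < t < j -> ~~ is_resp p (nth dflt_ev E t)].
Proof.
rewrite resp_ofE; case Ei: (nth dflt_ev E i) => [p o| |] //=; set s := drop _ _.
case Ej: (nth dflt_ev s _) => [| |p' r'] // [<- <-].
have fs : find (is_resp p) s < size s.
  by rewrite ltnNge; apply/negP => le; rewrite nth_default in Ej.
have := nth_find dflt_ev (etrans (has_find _ _) fs); rewrite Ej /= => /eqP p'p.
exists p, o; split=> //.
- by move: fs; rewrite size_drop; lia.
- by rewrite -nth_drop -/s Ej p'p.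
- move=> t /andP[it tf]; rewrite -(subnKC it) -nth_drop -/s.
  have tf' : t - i.+1 < find (is_resp p) s by lia.
  by rewrite (before_find dflt_ev tf').
Qed.

Lemma resp_of_completed E p i o t :
  nth dflt_ev E i = EInv p o -> i < t < size E -> is_resp p (nth dflt_ev E t) ->
  exists j r, resp_of E i = Some (j, r) /\ j <= t.
Proof.
move=> Ei tP resp; rewrite resp_ofE Ei /=; set s := drop _ _.
have nth_t : nth dflt_ev s (t - i.+1) = nth dflt_ev E t by rewrite nth_drop; congr nth; lia.
have hs : has (is_resp p) s.
  by apply/(has_nthP dflt_ev); exists (t - i.+1); [rewrite size_drop; lia | rewrite nth_t].
have := nth_find dflt_ev hs; case: (nth dflt_ev s _) => //= p' r _.
exists (i.+1 + find (is_resp p) s), r; split=> //.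
have : find (is_resp p) s <= t - i.+1.
  by rewrite leqNgt; apply/negP => /(before_find dflt_ev); rewrite nth_t resp.
lia.
Qed.

Lemma kind_run_cons q K Ks :
  kind_run q (K :: Ks) = if kind_step q K is Some q' then kind_run q' Ks else None.
Proof. by rewrite /kind_run /=; case: kind_step => //; elim: Ks. Qed.

Lemma pmap_filter_map (A B C : Type) (P : pred A) (f : A -> option B) (g : A -> C) d s :
  (forall i, P i -> f i <> None) ->
  pmap (fun i => if P i then if f i is Some o then Some (o, g i) else None else None) s
    = [seq (odflt d (f i), g i) | i <- s & P i].
Proof.
move=> Pf; elim: s => //= i s IHs; case Pi: (P i) => /=; rewrite IHs //.
by case fi: (f i) => [o|] //=; case: (Pf _ Pi).
Qed.

Definition is_take (o : op) : bool := if o is OTake then true else false.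
Definition is_steal (o : op) : bool := if o is OSteal then true else false.

(** With all outputs equal to [RVal x], no singleton pattern of [class_step] matches; the case
    analysis serves to reach its last branch. *)
Lemma class_step_val n x q (c : seq (op * resp)) :
  0 < size c -> all (fun pr => fits (KVal x) pr.1 && resp_eqb pr.2 (RVal x)) c ->
  count (is_take \o fst) c <= 1 -> count (is_steal \o fst) c <= n.-1 ->
  class_step n (x :: q) c = Some q.
Proof.
move=> c0 callx ctake csteal.
have {}callx : all (fun pr : op * resp => match pr with
    | (OTake, RVal y) => y == x | (OSteal, RVal y) => y == x | _ => false end) c.
  by apply: sub_all callx => -[[?||] [|?|]].
have cond : [&& 0 < size c, all (fun pr : op * resp => match pr with
      | (OTake, RVal y) => y == x | (OSteal, RVal y) => y == x | _ => false end) c,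
      count (fun pr => if pr.1 is OTake then true else false) c <= 1 &
      count (fun pr => if pr.1 is OSteal then true else false) c <= n.-1].
  by apply/and4P.
case: c c0 callx ctake csteal cond => // -[o r] [|b c] _; last first.
  by move=> _ _ _ cond; rewrite /class_step; case: o r cond => [?||] [|?|] -> .
by case: o r => [?||] [|?|] //= _ _ _ ->.
Qed.

Section Linearization.

Variables (n : nat) (E : seq event).

Hypothesis wf : forall p i j o o', i < j < size E ->
  nth dflt_ev E i = EInv p o -> nth dflt_ev E j = EInv p o' ->
  exists2 t, i < t < j & is_resp p (nth dflt_ev E t).
Hypothesis inv_allowed : forall i p o, nth dflt_ev E i = EInv p o -> allowed n p o.

Variables (log : seq kind) (cl : nat -> option nat) (len : nat -> nat) (q : seq nat).
Hypothesis ok : log_ok E log cl len q.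

Definition class_out (i : nat) : resp :=
  if cl i is Some k then kind_out (nth KEmpty log k) else RTrue.

(** The chain is [ka < len j.+1 <= len b <= kb]. *)
Lemma class_realtime a b ka kb j r :
  cl a = Some ka -> cl b = Some kb -> resp_of E a = Some (j, r) -> j < b -> ka < kb.
Proof.
move=> acl bcl /resp_ofP[p [o [ainv aj jresp noresp]]] jb.
have [k [ak kj _]] := log_resp ok ainv aj jresp noresp.
have [bE _ lb _] := log_class ok bcl.
move: ak; rewrite acl => -[e]; rewrite -e in kj.
by apply: leq_trans kj (leq_trans _ lb); apply: (log_mono ok); rewrite jb ltnW.
Qed.

(** Of two operations of one process, the first responds before the second is invoked, so
    [class_realtime] separates their classes. *)
Lemma class_process_inj i j k p o o' :
  cl i = Some k -> cl j = Some k ->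
  nth dflt_ev E i = EInv p o -> nth dflt_ev E j = EInv p o' -> i = j.
Proof.
wlog ij : i j o o' / i < j => [hw ik jk iinv jinv|ik jk iinv jinv].
  by case: (ltngtP i j) => // ij; [|symmetry]; eapply hw; eauto.
have [jE _ _ _] := log_class ok jk.
have [|t /andP[it tj] resp] := wf _ iinv jinv; first by rewrite ij.
have [|t' [r [iresp t't]]] := resp_of_completed iinv _ resp.
  by rewrite it (ltn_trans tj).
by have := class_realtime ik jk iresp (leq_ltn_trans t't tj); rewrite ltnn.
Qed.

Definition op_at (i : nat) : op := odflt OTake (inv_of E i).
Definition class_idx (k : nat) : seq nat := [seq i <- iota 0 (size E) | cl i == Some k].

Lemma mem_class_idx i k : (i \in class_idx k) = (cl i == Some k).
Proof.
rewrite mem_filter mem_iota andbC; case: eqP => [/(log_class ok)[iE _ _ _]|_]; last by rewrite andbF.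
by rewrite leq0n add0n iE.
Qed.

Lemma class_members_map k :
  class_members E cl class_out k = [seq (op_at i, class_out i) | i <- class_idx k].
Proof.
rewrite /class_members /class_idx /op_at (@pmap_filter_map _ _ _ _ _ _ OTake) // => i /eqP/(log_class ok).
by case=> _ _ _ [p [o [iinv _]]]; rewrite /inv_of iinv.
Qed.

Lemma class_members_single i k :
  cl i = Some k -> (forall x, nth KEmpty log k <> KVal x) ->
  class_members E cl class_out k = [:: (op_at i, class_out i)].
Proof.
move=> ik nv; rewrite class_members_map.
suff -> : class_idx k = [:: i] by [].
apply: perm_small_eq => //; apply: uniq_perm; rewrite ?filter_uniq ?iota_uniq // => j.
rewrite mem_class_idx inE; apply/eqP/eqP => [jk|->//].
exact: log_single ok _ _ _ jk ik nv.
Qed.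

(** Members of a class have distinct processes. With [procs] the owner alone or the list of thieves,
    this yields the bounds on Takes and on Steals. *)
Lemma count_class (P : pred op) (procs : seq nat) k :
  (forall p o, allowed n p o -> P o -> p \in procs) ->
  count (P \o fst) (class_members E cl class_out k) <= size procs.
Proof.
move=> Pprocs; rewrite class_members_map count_map.
rewrite -size_filter; set s := filter _ _.
pose proc i := if nth dflt_ev E i is EInv p _ then p else 0.
have sP i : i \in s -> exists p o, [/\ cl i = Some k, nth dflt_ev E i = EInv p o & P o].
  rewrite mem_filter mem_class_idx /= => /andP[Pi /eqP ik].
  have [_ _ _ [p [o [iinv _]]]] := log_class ok ik.
  by exists p, o; move: Pi; rewrite /op_at /inv_of iinv.
rewrite -(size_map proc); apply: uniq_leq_size.
  rewrite map_inj_in_uniq ?filter_uniq ?iota_uniq //.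
  move=> i j /sP[p [o [ik iinv _]]] /sP[p' [o' [jk jinv _]]].
  rewrite /proc iinv jinv => pp'; rewrite -pp' in jinv.
  exact: class_process_inj ik jk iinv jinv.
move=> _ /mapP[i /sP[p [o [_ iinv Po]]] ->].
by rewrite /proc iinv; apply: Pprocs Po; apply: inv_allowed iinv.
Qed.

Lemma class_step_members k q0 q1 :
  k < size log -> kind_step q0 (nth KEmpty log k) = Some q1 ->
  class_step n q0 (class_members E cl class_out k) = Some q1.
Proof.
move=> kl; have [i ik] := log_inhabited ok kl.
have [_ _ _ [p [o [iinv fo]]]] := log_class ok ik.
have opi : op_at i = o by rewrite /op_at /inv_of iinv.
case Kk: (nth KEmpty log k) fo => [x|x|].
- rewrite (class_members_single ik) ?Kk // opi /class_out ik Kk.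
  by case: o {iinv opi} => //= y /eqP ->.
- case: q0 => [|y q0] //= _; case: eqP => // -> [<-]; apply: class_step_val.
  + rewrite class_members_map size_map lt0n size_eq0.
    by apply/eqP => e; have := mem_class_idx i k; rewrite e ik eqxx.
  + rewrite class_members_map all_map; apply/allP => j; rewrite mem_class_idx => /eqP jk.
    have [_ _ _ [p' [o' [jinv fo']]]] := log_class ok jk.
    rewrite Kk in fo'; apply/andP; split; first by rewrite /op_at /inv_of jinv.
    by rewrite /class_out jk Kk /= eqxx.
  + by apply: (@count_class _ [:: 0]) => p' [z||] //= /eqP->.
  + rewrite -(size_iota 1 n.-1); apply: count_class => p' [z||] //= pn _.
    by rewrite mem_iota; lia.
- rewrite (class_members_single ik) ?Kk // opi /class_out ik Kk.
  by case: o {iinv opi} => //; case: q0.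
Qed.

Lemma log_set_linearizable : set_linearizable n E.
Proof.
exists (size log), cl, class_out; split.
- move=> i k /(log_class ok)[iE kl _ [p [o [iinv _]]]]; split=> //.
  by rewrite /inv_of iinv.
- move=> i j r /resp_ofP[p [o [iinv ij jresp noresp]]].
  have [k [ik _ kr]] := log_resp ok iinv ij jresp noresp.
  by rewrite /class_out ik.
- exact: class_realtime.
have accept b : forall a q0 q1, a + b = size log -> kind_run q0 (drop a log) = Some q1 ->
    spec_accepts n q0 [seq class_members E cl class_out k | k <- iota a b].
  elim: b => [|b IHb] a q0 q1 //= ab; have al : a < size log by lia.
  rewrite (drop_nth KEmpty al) kind_run_cons.
  case qa: (kind_step q0 _) => [q2|] // run.
  by rewrite (class_step_members al qa); apply: IHb run; lia.
by apply: (@accept _ 0 _ q); rewrite ?drop0 //; apply: log_run ok.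
Qed.

End Linearization.

(** * Executions, one event at a time *)

Lemma run_rcons n h pf tf c E e :
  run n h pf tf c (rcons E e) =
    if run n h pf tf c E is Some c' then exec_event n h pf tf c' e else None.
Proof.
elim: E c => [|e' E IHE] c /=; first by case: exec_event.
by case: (exec_event n h pf tf c e').
Qed.

Lemma resp_eqP a b : resp_eqb a b -> a = b.
Proof. by case: a b => [|x|] [|y|] //= /eqP->. Qed.

Definition pstep (mem : loc -> nat) (p : prog) : option ((loc -> nat) * prog) :=
  match p with
  | Ret _ => None
  | Read l k => Some (mem, k (mem l))
  | Write l v k => Some (upd mem l v, k)
  | CAS l a b k =>
      if mem l == a then Some (upd mem l b, k true) else Some (mem, k false)
  end.

Variant exec_spec n h pf tf (c : config) : event -> config -> Prop :=
| ExecInv p o t : cpend c p = None -> allowed n p o ->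
    t = (if o is OPut _ then (ctail c).+1 else ctail c) ->
    exec_spec n h pf tf c (EInv p o)
      (Cfg (cmem c) t (updp (cpend c) p (Some (o, op_prog h pf tf t o))))
| ExecStep p o pr mem' pr' : cpend c p = Some (o, pr) ->
    pstep (cmem c) pr = Some (mem', pr') ->
    exec_spec n h pf tf c (EStep p) (Cfg mem' (ctail c) (updp (cpend c) p (Some (o, pr'))))
| ExecResp p o r : cpend c p = Some (o, Ret r) ->
    exec_spec n h pf tf c (EResp p r) (Cfg (cmem c) (ctail c) (updp (cpend c) p None)).

Lemma exec_eventP n h pf tf c e c' :
  exec_event n h pf tf c e = Some c' -> exec_spec n h pf tf c e c'.
Proof.
case: e => [p o|p|p r] /=.
- by case pE: (cpend c p) => //; case: ifP => // al [<-]; apply: ExecInv.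
- case pE: (cpend c p) => [[o [r|l k|l v k|l a b k]]|] //.
  + by move=> [<-]; apply: ExecStep pE _.
  + by move=> [<-]; apply: ExecStep pE _.
  + by case: ifP => me [<-]; apply: (ExecStep _ _ _ _ pE); rewrite /= me.
- case pE: (cpend c p) => [[o [r'|l k|l v k|l a b k]]|] //.
  case: ifP => // /resp_eqP r'r [<-]; rewrite -r'r in pE.
  exact: ExecResp pE.
Qed.

(** The part of the invariant that is independent of the code being run; [trace_wf] says that each
    process is sequential. *)
Record trace_ok (n : nat) (E : seq event) (c : config) : Prop := TraceOk {
  trace_pending : forall p o pr, cpend c p = Some (o, pr) -> exists i, active E p i o;
  trace_active : forall p i o, active E p i o -> exists pr, cpend c p = Some (o, pr);
  trace_wf : forall p i j o o', i < j < size E ->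
    nth dflt_ev E i = EInv p o -> nth dflt_ev E j = EInv p o' ->
    exists2 t, i < t < j & is_resp p (nth dflt_ev E t);
  trace_allowed : forall i p o, nth dflt_ev E i = EInv p o -> allowed n p o;
  trace_tail : ctail c = num_puts E }.

Lemma active_inj n E c p i j o o' :
  trace_ok n E c -> active E p i o -> active E p j o' -> i = j.
Proof.
move=> tr; wlog ij : i j o o' / i < j => [hw ai aj|[iE iinv noresp] [jE jinv _]].
  by case: (ltngtP i j) => // ij; [|symmetry]; eapply hw; eauto.
have [|t /andP[it tj]] := trace_wf tr _ iinv jinv; first by rewrite ij.
by rewrite (negPf (noresp _ _)) // it (ltn_trans tj).
Qed.

Lemma trace_ok_rcons n h pf tf E c e c' :
  trace_ok n E c -> exec_spec n h pf tf c e c' -> trace_ok n (rcons E e) c'.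
Proof.
move=> tr ex; case: (tr) => pend act wf alw tail.
have inv_new p o : e = EInv p o -> cpend c p = None /\ allowed n p o.
  by case: ex => // q o' t qN al _ [<- <-].
split.
- move=> p o pr.
  case: ex => [q o' t qN al tE|q o' pr1 mem' pr' qS _|q o' r qS] /=;
    rewrite /updp; case: eqP => [->|/eqP pq].
  + by move=> [<- _]; exists (size E); apply/active_rcons; left.
  + by move=> /pend[i ai]; exists i; apply/active_rcons; right.
  + by move=> [<- _]; have [i ai] := pend _ _ _ qS; exists i; apply/active_rcons; right.
  + by move=> /pend[i ai]; exists i; apply/active_rcons; right.
  + by [].
  + move=> /pend[i ai]; exists i; apply/active_rcons; right; split=> //=.
    by rewrite eq_sym.
- move=> p i o /active_rcons.
  case: ex => [q o' t qN al tE|q o' pr1 mem' pr' qS _|q o' r qS] /=;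
    rewrite /updp => -[[_ //]|[ai nr]].
  + by case=> <- <-; rewrite eqxx; eexists.
  + have [pr prE] := act _ _ _ ai; case: eqP => [pq|_]; last by exists pr.
    by rewrite pq qN in prE.
  + have [pr prE] := act _ _ _ ai; case: eqP => [pq|_]; last by exists pr.
    by move: prE; rewrite pq qS => -[-> _]; eexists.
  + have [pr prE] := act _ _ _ ai; exists pr.
    by rewrite ifN // eq_sym.
- move=> p i j o o'; rewrite size_rcons ltnS => /andP[ij].
  rewrite leq_eqVlt => /orP[/eqP jE|jE]; last first.
    rewrite !nth_rcons jE (ltn_trans ij jE) => iinv jinv.
    have [|t tP tr'] := wf _ _ _ _ _ _ iinv jinv; first by rewrite ij.
    by exists t; rewrite // nth_rcons (ltn_trans _ jE) //; case/andP: tP.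
  rewrite jE in ij *; rewrite !nth_rcons ij ltnn eqxx => iinv eE.
  have [pN _] := inv_new _ _ eE.
  (* Without a response of [p] after [i], the operation would still be active and [p] could not
     invoke another. *)
  case hr: (has (is_resp p) (drop i.+1 E)).
    have /(has_nthP dflt_ev)[t] := hr; rewrite size_drop nth_drop => tE tr'.
    by exists (i.+1 + t); rewrite ?nth_rcons; [lia | rewrite (_ : _ < size E) //; lia].
  have [|pr prE] := act p i o; last by rewrite pN in prE.
  split=> // t /andP[it tE]; apply/negP => tr'.
  move/negP: hr; apply; apply/(has_nthP dflt_ev); exists (t - i.+1).
    by rewrite size_drop; lia.
  by rewrite nth_drop subnKC.
- move=> i p o; rewrite nth_rcons; case: ifP => _; first exact: alw.
  by case: ifP => // _ /inv_new[].
- rewrite /num_puts -cats1 count_cat -/(num_puts E) -tail.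
  by case: ex => [q o' t qN al ->|q o' pr1 mem' pr' qS _|q o' r qS] /=;
    [case: (o') => [?||] /=; lia | lia | lia].
Qed.

Lemma trace_ok_nil n init : trace_ok n [::] (init_cfg init).
Proof. by split=> // [p i o [] | p i j o o' /andP[] | i p o]; rewrite ?nth_nil. Qed.

(** * The invariant of executions *)

(* [xs]: the tasks whose write to Tasks has occurred; [hval]: the value of Head, minus
   one; [log], [cl], [len]: see [log_ok]; [rank r]: the position in the log of the
   class that removes the task of index [r]. *)
Record ghost := Ghost {
  xs : seq nat;
  hval : nat;
  log : seq kind;
  rank : nat -> nat;
  cl : nat -> option nat;
  len : nat -> nat }.

Section Invariant.

Variables (H : nat) (pf tf : bool).

(** A MaxRead returns at most Head, so by [shared_val] a Steal reads a register covered by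
    [shared_task] or [shared_next]. Tasks being positive, it finds 0 only just after the last
    task. *)
Record shared_ok (mem : loc -> nat) (g : ghost) : Prop := SharedOk {
  shared_bits : bits_ok H mem (hval g);
  shared_val : hval g <= size (xs g);
  shared_task : forall i, i < size (xs g) ->
    mem (LTask i.+1) = nth 0 (xs g) i /\ 0 < nth 0 (xs g) i;
  shared_next : mem (LTask (size (xs g)).+1) = 0;
  shared_rank : forall r, r < hval g ->
    rank g r < size (log g) /\ nth KEmpty (log g) (rank g r) = KVal (nth 0 (xs g) r) }.

Definition thief_or_take (o : op) : bool := if o is OPut _ then false else true.

(** What follows a MaxRead returning [r.+1]; the shift by one comes from storing Head minus one in
    the tree. *)
Definition after_read (o : op) (tail r : nat) : prog :=
  if o is OTake then
    if r.+1 <= tail then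
      if tf then Read (LTask r.+1) (fun x => head_write H r.+2 (Ret (RVal x)))
      else head_write H r.+2 (Read (LTask r.+1) (fun x => Ret (RVal x)))
    else Ret REmpty
  else Read (LTask r.+1) (fun x =>
    if x == 0 then Ret REmpty else head_write H r.+2 (Ret (RVal x))).

(* The state of the pending operation invoked at event [i].  [len g i <= rank g r]
   says that the class removing the task of index [r] is linearized after [i]. *)
Inductive phase (g : ghost) (mem : loc -> nat) (tail i : nat) : op -> prog -> Prop :=
| PhaseRead o h nd lo k :
    thief_or_take o -> at_node H h nd lo -> lo <= hval g ->
    (forall r, lo + 2 ^ h <= r.+1 -> r < hval g -> len g i <= rank g r) ->
    (forall v, k v = after_read o tail (lo + v)) -> cl g i = None ->
    phase g mem tail i o (mr_read h nd k)
| PhaseWrite o r k p :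
    thief_or_take o -> r <= hval g -> r < size (xs g) ->
    (r < hval g -> len g i <= rank g r) -> writing H (hval g) r.+1 k p ->
    k = Ret (RVal (nth 0 (xs g) r)) \/
      o = OTake /\ k = Read (LTask r.+1) (fun x => Ret (RVal x)) ->
    cl g i = None \/ r < hval g /\ cl g i = Some (rank g r) ->
    phase g mem tail i o p
| PhaseEmpty l :
    cl g i = Some l -> l < size (log g) -> nth KEmpty (log g) l = KEmpty ->
    phase g mem tail i OSteal (Ret REmpty)
| PhasePut x :
    0 < x -> tail = (size (xs g)).+1 -> cl g i = None ->
    mem (LTask (size (xs g)).+2) = 0 -> phase g mem tail i (OPut x) (put_prog pf tail x)
| PhasePutBot x l :
    tail = size (xs g) -> cl g i = Some l -> l < size (log g) ->
    nth KEmpty (log g) l = KPut x ->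
    phase g mem tail i (OPut x) (Write (LTask tail.+2) 0 (Ret RTrue))
| PhasePutTask x :
    0 < x -> tail = (size (xs g)).+1 -> cl g i = None ->
    mem (LTask (size (xs g)).+2) = 0 -> mem (LTask (size (xs g)).+3) = 0 ->
    phase g mem tail i (OPut x) (Write (LTask tail) x (Ret RTrue))
| PhasePutDone x l :
    tail = size (xs g) -> cl g i = Some l -> l < size (log g) ->
    nth KEmpty (log g) l = KPut x -> mem (LTask (size (xs g)).+2) = 0 ->
    phase g mem tail i (OPut x) (Ret RTrue).

(** What the operation invoked at [j] may rely on while others move. By [grows_fresh], tasks removed
    meanwhile have classes later than its invocation. *)
Record grows (j : nat) (g g' : ghost) : Prop := Grows {
  grows_val : hval g <= hval g';
  grows_xs : exists s, xs g' = xs g ++ s;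
  grows_log : exists s, log g' = log g ++ s;
  grows_rank : forall r, r < hval g -> rank g' r = rank g r;
  grows_fresh : forall r, hval g <= r < hval g' -> len g j <= rank g' r;
  grows_cl : cl g' j = cl g j;
  grows_len : len g' j = len g j }.

(** Stability under interference. The phases of a Steal depend neither on the tail nor on the
    contents of [Tasks]; a Put or Take belongs to the owner, and meanwhile the thieves change
    neither of these. *)
Lemma phase_grows g g' mem mem' tail tail' j o p :
  grows j g g' ->
  o = OSteal \/
    [/\ tail' = tail, xs g' = xs g & forall a, mem' (LTask a) = mem (LTask a)] ->
  phase g mem tail j o p -> phase g' mem' tail' j o p.
Proof.
case=> gval [s gxs] [l glog] grank gfresh gcl glen cond ph.
have xs_nth r : r < size (xs g) -> nth 0 (xs g') r = nth 0 (xs g) r.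
  by move=> rs; rewrite gxs nth_cat rs.
have log_nth r : r < size (log g) ->
    r < size (log g') /\ nth KEmpty (log g') r = nth KEmpty (log g) r.
  by move=> rs; rewrite glog size_cat nth_cat rs; split=> //; apply: ltn_addr.
have fresh r : (r < hval g -> len g j <= rank g r) -> r < hval g' -> len g' j <= rank g' r.
  move=> old rv'; rewrite glen; case: (ltnP r (hval g)) => rv; last by apply: gfresh; rewrite rv.
  by rewrite grank //; apply: old.
case: o p / ph cond => [o h nd lo k ot ndP lov fr kE clN|o r k p ot rv rx fr wr kE clP
  |m clS ml mE|x x0 tE clN m2|x m tE clS ml mE|x x0 tE clN m2 m3|x m tE clS ml mE m2] cond.
- apply: (@PhaseRead _ _ _ _ _ h nd lo) => //; last by rewrite gcl.
  + exact: leq_trans gval.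
  + by move=> r rl; apply: fresh; apply: fr.
  + by move=> v; rewrite kE; case: cond => [->//|[-> _ _]].
- apply: (@PhaseWrite _ _ _ _ _ r k) => //.
  + exact: leq_trans gval.
  + by rewrite gxs size_cat ltn_addr.
  + exact: fresh.
  + exact: writing_leq wr.
  + by case: kE => [->|]; [left; rewrite xs_nth | right].
  + rewrite gcl; case: clP => [|[rv' ->]]; [by left | right].
    by rewrite grank // (leq_trans rv').
- by have [ml' mE'] := log_nth _ ml; apply: (@PhaseEmpty _ _ _ _ m); rewrite ?gcl ?mE'.
- by case: cond => // -[-> xE mE']; apply: PhasePut; rewrite ?xE ?gcl ?mE'.
- have [ml' mE'] := log_nth _ ml.
  by case: cond => // -[-> xE _]; apply: (@PhasePutBot _ _ _ _ _ m); rewrite ?xE ?gcl ?mE'.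
- by case: cond => // -[-> xE mE']; apply: PhasePutTask; rewrite ?xE ?gcl ?mE'.
- have [ml' mE''] := log_nth _ ml.
  by case: cond => // -[-> xE mE']; apply: (@PhasePutDone _ _ _ _ _ m); rewrite ?xE ?gcl ?mE' ?mE''.
Qed.

(** The state between Puts. The next task goes to [(size (xs g)).+1], and the 0 behind it then marks
    the new end: this is why a Put clears a register two places ahead. *)
Definition quiet (g : ghost) (mem : loc -> nat) (tail : nat) : Prop :=
  tail = size (xs g) /\ mem (LTask (size (xs g)).+2) = 0.

Definition ghost_ok (E : seq event) (g : ghost) : Prop :=
  log_ok E (log g) (cl g) (len g) (drop (hval g) (xs g)).

(** The guarantee given by an event of operation [i], the counterpart of [grows]. A response fits as
    well, with unchanged memory and possibly a changed log. *)
Record local_spec (E : seq event) (i : nat) (o : op) (tail : nat)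
    (g : ghost) (mem : loc -> nat) (g' : ghost) (mem' : loc -> nat) : Prop := LocalSpec {
  local_log : ghost_ok E g';
  local_shared : shared_ok mem' g';
  local_tail : size (xs g') <= tail;
  local_grows : forall j, j != i -> j < size E -> grows j g g';
  local_task : thief_or_take o ->
    xs g' = xs g /\ forall a, mem' (LTask a) = mem (LTask a) }.

Lemma grows_refl j g : grows j g g.
Proof.
by split=> //; [exists [::]; rewrite cats0 | exists [::]; rewrite cats0 | move=> r; lia].
Qed.

Variables (E : seq event) (p i : nat) (o : op) (g : ghost) (mem : loc -> nat) (tail : nat).
Hypothesis act : active E p i o.
Hypothesis gok : ghost_ok E g.
Hypothesis sok : shared_ok mem g.
Hypothesis xs_tail : size (xs g) <= tail.
Hypothesis xs_bound : size (xs g) < 2 ^ H.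

Lemma local_id : local_spec E i o tail g mem g mem.
Proof. by split=> // j _ _; apply: grows_refl. Qed.

Lemma grows_set_cl k j : j != i ->
  grows j g (Ghost (xs g) (hval g) (log g) (rank g) (set_at (cl g) i k) (len g)).
Proof.
move=> ji; have [/= v x l rk f c n] := grows_refl j g.
by split=> //=; rewrite /set_at (negPf ji).
Qed.

(** Operation [i] opens a new class; [g0] supplies [xs], [hval] and [rank] as they are after the
    step. *)
Definition append (K : kind) (g0 : ghost) : ghost :=
  Ghost (xs g0) (hval g0) (rcons (log g) K) (rank g0) (set_at (cl g) i (Some (size (log g))))
    (set_at (len g) (size E) (size (log g)).+1).

Lemma grows_append K j g0 : j != i -> j < size E ->
  hval g <= hval g0 -> (exists s, xs g0 = xs g ++ s) ->
  (forall r, r < hval g -> rank g0 r = rank g r) ->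
  (forall r, hval g <= r < hval g0 -> rank g0 r = size (log g)) ->
  grows j g (append K g0).
Proof.
move=> ji jE vv xx rk fresh; split=> //=.
- by exists [:: K]; rewrite cats1.
- by move=> r /fresh ->; rewrite -(log_end gok); apply: (log_mono gok); rewrite leqnn ltnW.
- by rewrite /set_at (negPf ji).
- by rewrite /set_at ltn_eqF.
Qed.

Definition advance : ghost :=
  append (KVal (nth 0 (xs g) (hval g)))
    (Ghost (xs g) (hval g).+1 (log g) (set_at (rank g) (hval g) (size (log g))) (cl g) (len g)).

Lemma shared_rank_append K r : r < hval g ->
  rank g r < size (rcons (log g) K) /\
  nth KEmpty (rcons (log g) K) (rank g r) = KVal (nth 0 (xs g) r).
Proof.
move=> /(shared_rank sok)[rl rE].
by rewrite size_rcons nth_rcons rl; split=> //; apply: ltnW.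
Qed.

(** A write with [u <= hval g] is idle. Otherwise [u = (hval g).+1] and [w = hval g]: Head moves
    past the task [w], and the writer opens its removal class. It had no class before, since that
    would need [w < hval g]. *)
Lemma local_write_bit nd u w :
  thief_or_take o -> threshold H nd u -> u <= w.+1 -> w <= hval g -> w < size (xs g) ->
  (w < hval g -> len g i <= rank g w) ->
  (cl g i = None \/ w < hval g /\ cl g i = Some (rank g w)) ->
  exists g', [/\ local_spec E i o tail g mem g' (upd mem (LBit nd) 1),
     hval g' = maxn (hval g) u, xs g' = xs g, w < hval g' -> len g' i <= rank g' w &
     cl g' i = None \/ w < hval g' /\ cl g' i = Some (rank g' w)].
Proof.
move=> ot tu uw wv wx fr clP.
have uv1 : u <= (hval g).+1 by lia.
have bits := bits_ok_write (shared_bits sok) tu uv1.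
case: (boolP (u <= hval g)) => uv.
  exists g; split=> //; last by rewrite (maxn_idPl uv).
  rewrite (maxn_idPl uv) in bits; split=> //; last by move=> j _ _; apply: grows_refl.
  by case: sok => *; split.
rewrite -ltnNge in uv; have uE : u = (hval g).+1 by lia.
have wE : w = hval g by lia.
have clN : cl g i = None by case: clP => // -[]; lia.
rewrite (maxn_idPr (ltnW uv)) in bits *.
have [iE _ _] := act.
exists advance; split=> //=.
- split=> //=.
  + apply: log_ok_append gok act clN _ _; first by case: (o) ot.
    by rewrite -wE (drop_nth 0 wx) wE /= eqxx.
  + split=> //=; first by rewrite -uE.
    * by rewrite -wE.
    * exact: shared_task sok.
    * exact: shared_next sok.
    * move=> r; rewrite ltnS leq_eqVlt /set_at; case: eqP => [-> _|_ /= rv].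
        by rewrite size_rcons nth_rcons ltnn eqxx ltnSn.
      exact: shared_rank_append.
  + move=> j ji jE; apply: grows_append => //=.
    * by exists [::]; rewrite cats0.
    * by move=> r rv; rewrite /set_at ltn_eqF.
    * by move=> r rv; rewrite /set_at ifT //; lia.
- by rewrite /set_at wE eqxx ltn_eqF // -(log_end gok) => _; apply: (log_mono gok); rewrite leqnn ltnW.
- by right; rewrite /set_at wE !eqxx.
Qed.

Lemma phase_write_start g' mem' r k :
  thief_or_take o -> r <= hval g' -> r < size (xs g') -> size (xs g') < 2 ^ H ->
  (r < hval g' -> len g' i <= rank g' r) -> cl g' i = None ->
  k = Ret (RVal (nth 0 (xs g') r)) \/
    o = OTake /\ k = Read (LTask r.+1) (fun x => Ret (RVal x)) ->
  phase g' mem' tail i o (head_write H r.+2 k) /\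
  writing H (hval g') r.+1 k (head_write H r.+2 k).
Proof.
move=> ot rv rx xH fr clN kE.
have wr : writing H (hval g') r.+1 k (head_write H r.+2 k).
  rewrite /head_write /= -[r.+1]subn0 -[k in mr_write _ _ _ k]/(writes [::] k).
  rewrite {1}subn0; apply: writing_mr_write => //; first exact: at_root.
  - by rewrite add0n (leq_ltn_trans rx).
  - by left.
by split=> //; apply: (@PhaseWrite _ _ _ _ _ r k) => //; left.
Qed.

Lemma write_step r k pr mem' pr' :
  thief_or_take o -> r <= hval g -> r < size (xs g) ->
  (r < hval g -> len g i <= rank g r) -> writing H (hval g) r.+1 k pr ->
  k = Ret (RVal (nth 0 (xs g) r)) \/
    o = OTake /\ k = Read (LTask r.+1) (fun x => Ret (RVal x)) ->
  cl g i = None \/ r < hval g /\ cl g i = Some (rank g r) ->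
  pstep mem pr = Some (mem', pr') ->
  exists2 g', local_spec E i o tail g mem g' mem' & phase g' mem' tail i o pr'.
Proof.
move=> ot rv rx fr wr kE clP.
case: pr / wr => [h nd lo nds ndP loP bel hd|[|nd nds] bel hd].
- move=> [<- <-]; exists g; first exact: local_id.
  apply: (@PhaseWrite _ _ _ _ _ r k) => //.
  have -> : mem (LBit nd) = (lo + 2 ^ h <= hval g).
    by apply: (shared_bits sok); exists h, lo.
  (* A bit 1 shows that Head is at least [lo + 2 ^ h], beyond the value to be written. *)
  case: leqP => /= hv; first by apply: WritingUp => //; left; lia.
  by apply: writing_mr_write => //; apply: at_left.
(* With no write pending, only a Take that reads its task last has a step left. *)
- case: hd => // rv'; case: kE => [-> //|[oT -> [<- <-]]].
  exists g; first exact: local_id.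
  apply: (@PhaseWrite _ _ _ _ _ r (Ret (RVal (nth 0 (xs g) r)))) => //; last by left.
  have [-> _] := shared_task sok rx.
  by apply: (@WritingUp _ _ _ _ [::]) => //; left.
- move=> [<- <-]; have [u tu uw] := bel _ (mem_head _ _).
  have [g' [loc gv gx fr' clP']] := local_write_bit ot tu uw rv rx fr clP.
  have rv' : r <= hval g' by rewrite gv leq_max rv.
  exists g' => //; apply: (@PhaseWrite _ _ _ _ _ r k) => //; rewrite ?gx //.
  apply: WritingUp; first by move=> nd' nd'in; apply: bel; rewrite inE nd'in orbT.
  (* Either Head had already reached [r.+1] or this first write has that threshold; all remaining
     writes are idle. *)
  left; rewrite gv leq_max; case: hd => [->//|/= tw].
  by rewrite (threshold_fun tu tw) leqnn orbT.
Qed.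

(** In both orders, writing the task is the linearization point. The register known to hold 0
    provides [shared_next] for the longer [xs]. *)
Lemma local_put x :
  o = OPut x -> 0 < x -> tail = (size (xs g)).+1 -> cl g i = None ->
  mem (LTask (size (xs g)).+2) = 0 ->
  exists g', [/\ local_spec E i o tail g mem g' (upd mem (LTask tail) x),
    xs g' = rcons (xs g) x &
    exists l, [/\ cl g' i = Some l, l < size (log g') & nth KEmpty (log g') l = KPut x]].
Proof.
move=> oE x0 tE clN m2.
have mtask a : a != (size (xs g)).+1 -> upd mem (LTask tail) x (LTask a) = mem (LTask a).
  by rewrite /upd /= tE eq_sym => /negPf->.
exists (append (KPut x) (Ghost (rcons (xs g) x) (hval g) (log g) (rank g) (cl g) (len g))).
split=> //=; last first.
  by exists (size (log g)); rewrite /set_at eqxx size_rcons nth_rcons ltnn eqxx.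
split=> //=.
- apply: log_ok_append gok act clN _ _; first by rewrite oE /= eqxx.
  by rewrite /= drop_rcons ?(shared_val sok).
- split=> //=.
  + exact: shared_bits sok.
  + by rewrite size_rcons (leq_trans (shared_val sok)).
  + move=> a; rewrite size_rcons ltnS leq_eqVlt nth_rcons => /orP[/eqP->|ax].
      by rewrite /upd /= tE ltnn !eqxx.
    by rewrite ax mtask; [apply: (shared_task sok) | rewrite eqSS ltn_eqF].
  + by rewrite size_rcons mtask // gtn_eqF.
  + move=> r rv; have [rl rE] := shared_rank_append (KPut x) rv; split=> //.
    by rewrite rE nth_rcons (leq_trans rv (shared_val sok)).
- by rewrite size_rcons tE.
- move=> j ji jE; apply: grows_append => //=; first by exists [:: x]; rewrite cats1.
  by move=> r; lia.
- by rewrite oE.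
Qed.

Lemma local_empty :
  thief_or_take o -> hval g = size (xs g) -> cl g i = None ->
  local_spec E i o tail g mem (append KEmpty g) mem.
Proof.
move=> ot vx clN; split=> //.
- apply: log_ok_append gok act clN _ _; first by case: (o) ot.
  by rewrite /= vx drop_size.
- case: (sok) => bits vx' task next _; split=> //= r.
  exact: shared_rank_append.
- move=> j ji jE; apply: grows_append => //; first by exists [::]; rewrite cats0.
  by move=> r; lia.
Qed.

Lemma local_write_task x a :
  (forall b, b < size (xs g) -> a != b.+1) -> a != (size (xs g)).+1 ->
  ~~ thief_or_take o ->
  local_spec E i o tail g mem g (upd mem (LTask a) x).
Proof.
move=> old next op; split=> //; last by case: (o) op.
  case: (sok) => bits vx task nx rk; split=> //.
    by move=> b bx; rewrite /upd /= (negPf (old _ bx)); apply: task.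
  by rewrite /upd /= (negPf next).
by move=> j _ _; apply: grows_refl.
Qed.

Lemma local_step o' pr mem' pr' :
  phase g mem tail i o' pr -> o' = o -> (o = OTake -> quiet g mem tail) ->
  pstep mem pr = Some (mem', pr') ->
  exists2 g', local_spec E i o tail g mem g' mem' & phase g' mem' tail i o pr'.
Proof.
move=> ph; case: o' pr / ph => [o' h nd lo k ot ndP lov fr kE clN
  |o' r k pr ot rv rx fr wr kE clP
  |m clS ml mE|x x0 tE clN m2|x m tE clS ml mE|x x0 tE clN m2 m3|x m tE clS ml mE m2] oE qt.
- rewrite {}oE in ot kE; case: h => [|h] in ndP fr *; last first.
    move=> [<- <-]; exists g; first exact: local_id.
    have -> : mem (LBit nd) = (lo + 2 ^ h <= hval g).
      by apply: (shared_bits sok); exists h, lo.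
    case: leqP => /= hv.
      apply: (@PhaseRead _ _ _ _ _ h nd.*2.+1 (lo + 2 ^ h)) => //; first exact: at_right.
        by move=> r rl; apply: fr; rewrite expnS; lia.
      by move=> v; rewrite kE addnA.
    (* A bit 0 shows that Head is still below [lo + 2 ^ h], so the bound on ranks is vacuous now;
       later removals satisfy it by [grows_fresh]. *)
    apply: (@PhaseRead _ _ _ _ _ h nd.*2 lo) => //; first exact: at_left.
    by move=> r; lia.
  (* At height 0 MaxRead has returned [lo]: the task [lo], if removed by now, was removed after the
     invocation. *)
  have {}fr : lo < hval g -> len g i <= rank g lo by apply: fr; rewrite expn0 addn1.
  rewrite /= kE addn0.
  have read_ok : lo < size (xs g) ->
      phase g mem tail i o (head_write H lo.+2 (Ret (RVal (mem (LTask lo.+1))))).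
    move=> lx; have [-> _] := shared_task sok lx.
    by have [] := @phase_write_start g mem lo _ ot lov lx xs_bound fr clN (or_introl (erefl _)).
  have [oE|oE] : o = OSteal \/ o = OTake by case: (o) ot; auto.
    rewrite /after_read {1}oE => -[<- <-]; case: eqP => m0; last first.
      exists g; first exact: local_id.
      apply: read_ok; rewrite ltn_neqAle (leq_trans lov) ?(shared_val sok) // andbT.
      by apply/eqP => e; apply: m0; rewrite e; apply: (shared_next sok).
    (* If a task were left, [lo] would be the index of a task and its register positive. So the
       queue is empty at this read, where the Steal is linearized. *)
    have vx : hval g = size (xs g).
      apply/eqP; rewrite eqn_leq (shared_val sok) /= leqNgt; apply/negP => vx.
      by have [] := shared_task sok (leq_ltn_trans lov vx); rewrite m0 => <-.
    exists (append KEmpty g); first by apply: local_empty.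
    rewrite oE; apply: (@PhaseEmpty _ _ _ _ (size (log g))); rewrite /= ?size_rcons //.
      by rewrite /set_at eqxx.
    by rewrite nth_rcons ltnn eqxx.
  have [tE _] := qt oE; rewrite /after_read {1}oE; case: ifP => // lt.
  rewrite tE in lt; case: {+}tf.
    by move=> [<- <-]; exists g; [exact: local_id | apply: read_ok].
  (* When the task is read last, no access separates MaxRead from MaxWrite: the same program is
     already in its write phase. *)
  move=> st; have [_ wr] := @phase_write_start g mem lo _ ot lov lt xs_bound fr clN
    (or_intror (conj oE (erefl _))).
  by apply: write_step wr _ _ st => //; [right | left].
- by rewrite oE in ot kE; apply: write_step wr kE clP.
- by [].
- rewrite /put_prog; case: {+}pf => -[<- <-].
    have [g' [loc gx [l [lE ls lk]]]] := local_put (esym oE) x0 tE clN m2.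
    exists g' => //; rewrite -oE.
    by apply: (@PhasePutBot _ _ _ _ _ l) => //; rewrite gx size_rcons.
  exists g; first by apply: local_write_task; rewrite -?oE // => *; lia.
  rewrite -oE; apply: PhasePutTask => //.
    by rewrite /upd /= tE; case: eqP => //; lia.
  by rewrite /upd /= tE eqxx.
- move=> [<- <-]; exists g; first by apply: local_write_task; rewrite -?oE // => *; lia.
  rewrite -oE; apply: (@PhasePutDone _ _ _ _ _ m) => //.
  by rewrite /upd /= tE eqxx.
- move=> [<- <-].
  have [g' [loc gx [l [lE ls lk]]]] := local_put (esym oE) x0 tE clN m2.
  exists g' => //; rewrite -oE.
  apply: (@PhasePutDone _ _ _ _ _ l) => //; rewrite gx size_rcons //.
  by rewrite /upd /= tE; case: eqP => //; lia.
- by [].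
Qed.

(** An operation returning the task [s] has completed its MaxWrite, so Head has passed [s]; it joins
    the removal class of [s] unless it is in it already. An empty Take opens its class here. *)
Lemma local_resp o' pr r :
  phase g mem tail i o' pr -> o' = o -> pr = Ret r -> (o = OTake -> quiet g mem tail) ->
  exists g', [/\ local_spec E i o tail g mem g' mem,
    exists2 k, cl g' i = Some k & kind_out (nth KEmpty (log g') k) = r &
    ~~ thief_or_take o -> quiet g' mem tail].
Proof.
have write_resp s k : thief_or_take o -> s < size (xs g) ->
    (s < hval g -> len g i <= rank g s) -> writing H (hval g) s.+1 k (Ret r) ->
    k = Ret (RVal (nth 0 (xs g) s)) \/
      o = OTake /\ k = Read (LTask s.+1) (fun x => Ret (RVal x)) ->
    cl g i = None \/ s < hval g /\ cl g i = Some (rank g s) ->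
    exists g', [/\ local_spec E i o tail g mem g' mem,
      exists2 k, cl g' i = Some k & kind_out (nth KEmpty (log g') k) = r &
      ~~ thief_or_take o -> quiet g' mem tail].
  move=> ot sx fr wr kE clP.
  have [kr sv] := writing_Ret wr.
  case: kE => [kE|[_ kE]]; last by rewrite kE in kr.
  have [rl rE] := shared_rank sok sv.
  have rr : kind_out (nth KEmpty (log g) (rank g s)) = r.
    by rewrite rE /=; move: kr; rewrite kE => -[].
  exists (Ghost (xs g) (hval g) (log g) (rank g) (set_at (cl g) i (Some (rank g s))) (len g)).
  split; last by rewrite ot.
    split=> //.
    + apply: log_ok_join gok act _ rl rE (fr sv) _; last by case: (o) ot.
      by case: clP => [|[]]; [left | right].
    + by case: sok => *; split.
    + by move=> j ji _; apply: grows_set_cl.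
  by exists (rank g s) => //; rewrite /set_at /= eqxx.
move=> ph; case: o' pr / ph => [o' h nd lo k ot ndP lov fr kE clN
  |o' s k pr ot rv rx fr wr kE clP
  |m clS ml mE|x x0 tE clN m2|x m tE clS ml mE|x x0 tE clN m2 m3|x m tE clS ml mE m2] oE prE qt.
- rewrite {}oE in ot kE; case: h => [|//] in ndP fr prE *.
  have {}fr : lo < hval g -> len g i <= rank g lo by apply: fr; rewrite expn0 addn1.
  move: prE; rewrite /= kE addn0.
  have [oE|oE] : o = OSteal \/ o = OTake by case: (o) ot; auto.
    by rewrite /after_read oE.
  have [tE _] := qt oE; rewrite /after_read {1}oE; case: ifP => [lt|/negbT].
    rewrite tE in lt; case: {+}tf => // wE.
    have [_ wr] := @phase_write_start g mem lo _ ot lov lt xs_bound fr clN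
      (or_intror (conj oE (erefl _))).
    rewrite wE in wr; apply: write_resp wr _ _ => //; [by right | by left].
  rewrite -leqNgt => xl [<-]; rewrite tE in xl.
  (* The tail of the owner is the number of tasks, [lo] is not below it, and Head lies between the
     two. *)
  have vx : hval g = size (xs g).
    by apply/eqP; rewrite eqn_leq (shared_val sok) (leq_trans xl).
  exists (append KEmpty g); split; [exact: local_empty | | by rewrite ot].
  by exists (size (log g)); rewrite /= ?/set_at ?eqxx // nth_rcons ltnn eqxx.
- rewrite oE in ot kE; rewrite prE in wr; exact: write_resp wr kE clP.
- exists g; split; [exact: local_id | | by rewrite -oE].
  by exists m => //; rewrite mE; case: prE.
- by move: prE; rewrite /put_prog; case: pf.
- by [].
- by [].
- exists g; split; [exact: local_id | | by []].
  by exists m => //; rewrite mE; case: prE.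
Qed.

End Invariant.

(** * Preservation of the invariant along executions *)

Record inv (n H : nat) (pf tf : bool) (E : seq event) (c : config) (g : ghost) : Prop := Inv {
  inv_trace : trace_ok n E c;
  inv_log : ghost_ok E g;
  inv_shared : shared_ok H (cmem c) g;
  inv_tail : size (xs g) <= ctail c;
  inv_phase : forall p i o pr, cpend c p = Some (o, pr) -> active E p i o ->
    phase H pf tf g (cmem c) (ctail c) i o pr;
  inv_quiet : (forall x pr, cpend c 0 <> Some (OPut x, pr)) ->
    quiet g (cmem c) (ctail c) }.

Definition after_event (E : seq event) (g : ghost) : ghost :=
  Ghost (xs g) (hval g) (log g) (rank g) (cl g) (set_at (len g) (size E).+1 (size (log g))).

Lemma grows_after_event E j g : j <= size E -> grows j g (after_event E g).
Proof.
move=> jE; case: (grows_refl j g) => *; split=> //=.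
by rewrite /set_at ltn_eqF.
Qed.

Lemma shared_after_event H mem E g :
  shared_ok H mem g -> shared_ok H mem (after_event E g).
Proof. by case=> *; split. Qed.

Lemma active_allowed n E c p i o : trace_ok n E c -> active E p i o -> allowed n p o.
Proof. by move=> tr [_ iinv _]; apply: trace_allowed tr _ _ _ iinv. Qed.

Lemma owner_or_steal n p o : allowed n p o -> p = 0 \/ o = OSteal.
Proof. by case: o => [x||] /=; [case/andP => /eqP; left | move/eqP; left | right]. Qed.

Lemma inv_local n H pf tf E c g p i o e mem' g' pd :
  inv n H pf tf E c g -> active E p i o -> (exists pr, cpend c p = Some (o, pr)) ->
  local_spec H E i o (ctail c) g (cmem c) g' mem' ->
  trace_ok n (rcons E e) (Cfg mem' (ctail c) (updp (cpend c) p pd)) ->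
  (forall p' i' o', active (rcons E e) p' i' o' -> active E p' i' o') ->
  (forall q r j o', e = EResp q r -> active E q j o' ->
     exists2 k, cl g' j = Some k & kind_out (nth KEmpty (log g') k) = r) ->
  (if pd is Some (o', pr) then o' = o /\ phase H pf tf g' mem' (ctail c) i o pr
   else ~~ thief_or_take o -> quiet g' mem' (ctail c)) ->
  inv n H pf tf (rcons E e) (Cfg mem' (ctail c) (updp (cpend c) p pd)) (after_event E g').
Proof.
move=> [tr gok sok xt ph qt] act [pr0 pE] [gok' sok' xt' gr task] tr' actE eresp pdP.
have alw := active_allowed tr act.
split=> //=.
- exact: log_ok_event gok' eresp.
- exact: shared_after_event.
- move=> p' j o' pr; rewrite /updp; case: eqP => [->|/eqP p'p] pE' /actE act'.
    rewrite (active_inj tr act' act) {}pE' in pdP *; case: pdP => -> ph'.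
    apply: phase_grows ph'; last by right.
    by apply: grows_after_event; case: act => /ltnW.
  have ji : j != i.
    apply/eqP => ji; case: act act' => _ iinv _ [_ jinv _].
    by move/eqP: p'p; apply; move: jinv; rewrite ji iinv => -[].
  have jE : j < size E by case: act'.
  apply: (@phase_grows H pf tf g' _ mem' _ (ctail c)); last first.
  + apply: phase_grows (ph _ _ _ _ pE' act'); first exact: gr.
    (* If the other operation is no Steal, it is the owner's; then [p] is a thief and leaves [Tasks]
       and [xs] alone. *)
    have [p'0|->] := owner_or_steal (active_allowed tr act'); last by left.
    right; case: task => [|-> mE]; last by [].
    have [p0|->//] := owner_or_steal alw.
    by rewrite p0 p'0 in p'p.
  + by right.
  + by apply: grows_after_event; apply: ltnW.
- move=> npend.
  have keep : thief_or_take o -> quiet g' mem' (ctail c).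
    move=> ot; have [xE mE] := task ot; rewrite /quiet xE mE; apply: qt => x pr c0.
    have [p0|oS] := owner_or_steal alw; first by move: c0 ot; rewrite -p0 pE => -[->].
    have pn0 : p != 0 by move: alw; rewrite oS /= lt0n => /andP[].
    by apply: (npend x pr); rewrite /updp eq_sym (negPf pn0).
  suff : quiet g' mem' (ctail c) by [].
  case ot: (thief_or_take o); first exact: keep.
  case: pd pdP npend {tr'} => [[o' pr] [-> _]|]; last by move=> qt' _; apply: qt'; rewrite ot.
  have [p0|oS] := owner_or_steal alw; last by rewrite oS in ot.
  by case: (o) ot => // x _ /(_ x pr); rewrite /updp p0 eqxx.
Qed.

Lemma num_puts_rcons E e : num_puts E <= num_puts (rcons E e).
Proof. by rewrite /num_puts -cats1 count_cat leq_addr. Qed.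

Lemma inv_step n H pf tf E c g e c' :
  inv n H pf tf E c g -> exec_spec n H pf tf c e c' -> num_puts (rcons E e) < 2 ^ H ->
  exists g', inv n H pf tf (rcons E e) c' g'.
Proof.
move=> I ex; case: (I) => tr gok sok xt ph qt bound.
have tr' := trace_ok_rcons tr ex.
have xH : size (xs g) < 2 ^ H.
  apply: leq_ltn_trans xt (leq_ltn_trans _ bound).
  by rewrite (trace_tail tr) num_puts_rcons.
have take_quiet p i o pr : cpend c p = Some (o, pr) -> active E p i o ->
    o = OTake -> quiet g (cmem c) (ctail c).
  move=> pE act oT; apply: qt => x pr' c0.
  have := active_allowed tr act; rewrite oT /= => /eqP p0.
  by rewrite -p0 pE oT in c0.
case: ex tr' => [p o t pN al tE|p o pr mem' pr' pE st|p o r pE] tr'.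
- exists (after_event E g).
  have clN : cl g (size E) = None.
    by case clE: (cl g _) => [k|//]; have [] := log_class gok clE; rewrite ltnn.
  split=> //=.
  + by apply: log_ok_event gok _.
  + exact: shared_after_event.
  + by rewrite tE; case: (o) => *; lia.
  + move=> p' j o' pr; rewrite /updp; case: eqP => [->|/eqP p'p].
      move=> [<- <-] /active_rcons[[-> _]|[act _]]; last first.
        by have [pr' pE] := trace_active tr act; rewrite pN in pE.
      have read_ok : thief_or_take o ->
          phase H pf tf (after_event E g) (cmem c) t (size E) o
            (mr_read H 1 (after_read H tf o t)).
        move=> ot; apply: (@PhaseRead _ _ _ _ _ _ _ _ H 1 0) => //; first exact: at_root.
        (* Head stays below [2 ^ H], so at the root no removed task is subject to the bound on
           ranks. *)
        move=> r rl rv; have vx := shared_val sok; simpl in rv; lia.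
      case: o al tE read_ok {tr'} => [x||] al tE read_ok; [|exact: (read_ok isT)|exact: (read_ok isT)].
      have [pz x0] := andP al; rewrite (eqP pz) in pN.
      have [tx m2] : quiet g (cmem c) (ctail c) by apply: qt => y pr'; rewrite pN.
      by apply: PhasePut => //=; rewrite tE tx.
    move=> pE /active_rcons[[_ [pp _]]|[act _]]; first by rewrite pp eqxx in p'p.
    have jE : j < size E by case: act.
    apply: phase_grows (ph _ _ _ _ pE act); first by apply: grows_after_event; apply: ltnW.
    have [p'0|->] := owner_or_steal (active_allowed tr act); last by left.
    right; split=> //; rewrite tE.
    by have [p0|->//] := owner_or_steal al; rewrite p0 p'0 in p'p.
  + move=> npend.
    have tc : t = ctail c.
      rewrite tE; case: (o) al npend => // x /andP[/eqP-> _] /(_ x (op_prog H pf tf t (OPut x))).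
      by rewrite /updp eqxx.
    rewrite tc; suff : quiet g (cmem c) (ctail c) by [].
    apply: qt => x pr c0; apply: (npend x pr); rewrite /updp.
    by case: eqP => // p0; rewrite -p0 c0 in pN.
- have [i act] := trace_pending tr pE.
  have [g' loc ph'] := local_step act gok sok xt xH (ph _ _ _ _ pE act) erefl
    (take_quiet _ _ _ _ pE act) st.
  exists (after_event E g'); apply: (inv_local I act _ loc tr' _ _ _) => //.
  + by exists pr.
  + by move=> p' i' o' /active_rcons[[]|[]].
- have [i act] := trace_pending tr pE.
  have [g' [loc [k ik kr] qt']] := local_resp act gok sok xt xH (ph _ _ _ _ pE act) erefl
    erefl (take_quiet _ _ _ _ pE act).
  exists (after_event E g'); apply: (inv_local I act _ loc tr' _ _ _) => //.
  + by exists (Ret r).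
  + by move=> p' i' o' /active_rcons[[]|[]].
  + by move=> q r' j o' [<- <-] act'; rewrite (active_inj tr act' act); exists k.
Qed.

(** [init 1 = 0] gives [shared_next], and [init 2 = 0] gives [quiet]. Thresholds are positive, so
    the all-zero tree represents 0. *)
Lemma inv_init n H pf tf init :
  init 1 = 0 -> init 2 = 0 ->
  inv n H pf tf [::] (init_cfg init)
    (Ghost [::] 0 [::] id (fun=> None) (fun=> 0)).
Proof.
move=> init1 init2; split=> //.
- exact: trace_ok_nil.
- by split=> // i j p o r _ /andP[].
- by split=> // nd u /threshold_gt0; case: u.
Qed.

Lemma execution_inv n H pf tf init E c :
  init 1 = 0 -> init 2 = 0 -> run n H pf tf (init_cfg init) E = Some c ->
  num_puts E < 2 ^ H -> exists g, inv n H pf tf E c g.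
Proof.
move=> init1 init2; elim/last_ind: E c => [|E e IHE] c.
  by move=> [<-] _; eexists; apply: inv_init.
rewrite run_rcons; case runE: run => [c1|//] /exec_eventP ex bound.
have [g I] := IHE _ runE (leq_ltn_trans (num_puts_rcons E e) bound).
exact: inv_step I ex bound.
Qed.

Lemma execution_set_linearizable n m pf tf init E :
  init 1 = 0 -> init 2 = 0 -> is_execution n (head_height m) pf tf init E ->
  num_puts E <= m -> set_linearizable n E.
Proof.
move=> init1 init2 [c runE] putsE.
have [g [tr gok _ _ _ _]] :=
  execution_inv init1 init2 runE (leq_ltn_trans putsE (ltn_head_height m)).
exact: (log_set_linearizable (@trace_wf _ _ _ tr) (@trace_allowed _ _ _ tr) gok).
Qed.

Theorem theorem2 :
  exists c : nat,
  forall (n m : nat) (put_first_x take_read_first : bool) (init : nat -> nat),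
    2 <= n -> init 1 = 0 -> init 2 = 0 ->
    [/\ (* set-linearizability of every finite execution with at most m Puts *)
        (forall E : seq event,
           is_execution n (head_height m) put_first_x take_read_first init E ->
           num_puts E <= m -> set_linearizable n E),
        (* only Read/Write instructions *)
        (forall (tail : nat) (o : op),
           only_rw (op_prog (head_height m) put_first_x take_read_first tail o)),
        (* O(log m) step complexity of Take and Steal *)
        (forall tail : nat,
           steps_le (take_prog (head_height m) take_read_first tail)
                    (c * trunc_log 2 m + c)) /\
        steps_le (steal_prog (head_height m)) (c * trunc_log 2 m + c) &
        (* no Read-After-Write in Steal, nor in Take (Tasks read first) *)
        no_raw (steal_prog (head_height m)) /\
        (take_read_first = true ->
           forall tail : nat, no_raw (take_prog (head_height m) take_read_first tail))].
Proof.
(* With height [h] at most [trunc_log 2 m + 1], the [2h + 1] accesses (MaxRead, MaxWrite and one to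
   [Tasks]) number at most [2 * trunc_log 2 m + 3]. *)
exists 3 => n m pf tf init _ init1 init2; have hm := head_height_le m; split.
- by move=> E; apply: execution_set_linearizable.
- exact: only_rw_op_prog.
- split=> [tail|]; [apply: steps_le_trans (steps_le_take _ _ _) _ |
                    apply: steps_le_trans (steps_le_steal _) _]; lia.
- by split=> [|->]; [apply: no_raw_steal | apply: no_raw_take].
Qed.
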